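(* Let $H$ and $G$ be topological groupoids with a classical action of $H$ on $G$, with anchor maps $r_H\colon G^0\to H^0$ and $r_H\colon G^1\to H^0$, and let $L$ be its transformation groupoid. The map $r_H\colon L^0=G^0\to H^0$ on objects and the coordinate projection $\mathrm{pr}_1\colon L^1=H^1\times_{s,H^0,r_H}G^1\to H^1$ on arrows define a continuous functor $F\colon L\to H$, which is a groupoid fibration.
   Context: A topological groupoid $L$ has (arbitrary) topological spaces $L^0$ of objects and $L^1$ of arrows, open continuous range and source maps $r,s\colon L^1\to L^0$, and continuous multiplication, inversion and unit maps. A groupoid fibration is a continuous functor $F\colon L\to H$ (continuous maps $F^i\colon L^i\to H^i$, $i=0,1$, compatible with $r$, $s$ and multiplication) such that $(F^1,s)\colon L^1\to H^1\times_{s,H^0,F^0}L^0=\{(h,x): s(h)=F^0(x)\}$ is an open surjection. A (left) action of $H$ on a space $X$ is a continuous anchor map $r_H\colon X\to H^0$ with a continuous map $H^1\times_{s,H^0,r_H}X\to X$, $(h,x)\mapsto h\cdot x$, such that $r_H(h\cdot x)=r(h)$, $h_1\cdot(h_2\cdot x)=(h_1h_2)\cdot x$, $1_{r_H(x)}\cdot x=x$. A classical action of $H$ on $G$ consists of $H$-actions on $G^0$ and $G^1$ such that $r,s\colon G^1\to G^0$ are $H$-equivariant and the multiplication $G^1\times_{s,G^0,r}G^1\to G^1$ is $H$-equivariant for the diagonal action, that is, $h\cdot(g_1g_2)=(h\cdot g_1)(h\cdot g_2)$. The transformation groupoid $L$ of a classical action is the topological groupoid with $L^0=G^0$, $L^1=H^1\times_{s,H^0,r_H}G^1$,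 $s(h,g)=s(g)$, $r(h,g)=h\cdot r(g)$, and $(h_1,g_1)\cdot(h_2,g_2)=(h_1h_2,(h_2^{-1}\cdot g_1)\cdot g_2)$ whenever $s(g_1)=h_2\cdot r(g_2)$. *)

(* Defs.v *)
From HB Require Import structures.
From mathcomp Require Import all_boot.
From mathcomp Require Import all_classical topology.

Set Implicit Arguments.
Unset Strict Implicit.
Unset Printing Implicit Defensive.

Local Open Scope classical_set_scope.

(* As a type, this is a [set_type], which carries the subspace topology of the
   product topology when A and B are topological spaces. *)
Definition fiber_product (A B C : Type) (f : A -> C) (g : B -> C) :
  set (A * B) := [set p | f p.1 = g p.2].

Definition fpair (A B C : Type) (f : A -> C) (g : B -> C) (a : A) (b : B)
  (e : f a = g b) : fiber_product f g :=
  SigSub (@mem_set _ (fiber_product f g) (a, b) e).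

Definition open_map (X Y : topologicalType) (f : X -> Y) :=
  forall U : set X, open U -> open (f @` U).

Definition open_surjection (X Y : topologicalType) (f : X -> Y) :=
  open_map f /\ range f = [set: Y].

(* A product g1 g2 is defined when src g1 = rng g2. The laws below quantify over
   all proofs of the composability conditions; conditions such as [e] and [e']
   in [gmulA] follow from the other laws, so they do not restrict anything. *)
Record topGroupoid := TopGroupoid {
  obj : topologicalType;
  arr : topologicalType;
  rng : arr -> obj;
  src : arr -> obj;
  gmul : fiber_product src rng -> arr;
  ginv : arr -> arr;
  gunit : obj -> arr;
  rng_continuous : continuous rng;
  src_continuous : continuous src;
  rng_open : open_map rng;
  src_open : open_map src;
  gmul_continuous : continuous gmul;
  ginv_continuous : continuous ginv;
  gunit_continuous : continuous gunit;
  rng_mul : forall g1 g2 (e : src g1 = rng g2), rng (gmul (fpair e)) = rng g1;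
  src_mul : forall g1 g2 (e : src g1 = rng g2), src (gmul (fpair e)) = src g2;
  gmulA : forall g1 g2 g3 (e12 : src g1 = rng g2) (e23 : src g2 = rng g3)
    (e : src (gmul (fpair e12)) = rng g3)
    (e' : src g1 = rng (gmul (fpair e23))),
    gmul (fpair e) = gmul (fpair e');
  rng_unit : forall x, rng (gunit x) = x;
  src_unit : forall x, src (gunit x) = x;
  gmul1g : forall g (e : src (gunit (rng g)) = rng g), gmul (fpair e) = g;
  gmulg1 : forall g (e : src g = rng (gunit (src g))), gmul (fpair e) = g;
  rng_inv : forall g, rng (ginv g) = src g;
  src_inv : forall g, src (ginv g) = rng g;
  gmulVg : forall g (e : src (ginv g) = rng g),
    gmul (fpair e) = gunit (src g);
  gmulgV : forall g (e : src g = rng (ginv g)),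
    gmul (fpair e) = gunit (rng g)
}.

Record continuousFunctor (L H : topGroupoid) := ContinuousFunctor {
  fobj : obj L -> obj H;
  farr : arr L -> arr H;
  fobj_continuous : continuous fobj;
  farr_continuous : continuous farr;
  rng_farr : forall l, rng (farr l) = fobj (rng l);
  src_farr : forall l, src (farr l) = fobj (src l);
  farr_mul : forall l1 l2 (e : src l1 = rng l2)
    (e' : src (farr l1) = rng (farr l2)),
    farr (gmul (fpair e)) = gmul (fpair e')
}.

(* The map (F^1, s) : L^1 -> H^1 x_{s, H^0, F^0} L^0. *)
Definition farr_src (L H : topGroupoid) (F : continuousFunctor L H) (l : arr L)
  : fiber_product (@src H) (fobj F) := fpair (src_farr F l).

Definition groupoid_fibration (L H : topGroupoid) (F : continuousFunctor L H) :=
  open_surjection (farr_src F).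

Record groupoidAction (H : topGroupoid) (X : topologicalType) :=
  GroupoidAction {
  anchor : X -> obj H;
  act : fiber_product (@src H) anchor -> X;
  anchor_continuous : continuous anchor;
  act_continuous : continuous act;
  anchor_act : forall h x (e : src h = anchor x),
    anchor (act (fpair e)) = rng h;
  actA : forall h1 h2 x (e2 : src h2 = anchor x)
    (e1 : src h1 = anchor (act (fpair e2))) (e12 : src h1 = rng h2)
    (e : src (gmul (fpair e12)) = anchor x),
    act (fpair e1) = act (fpair e);
  act1 : forall x (e : src (gunit (anchor x)) = anchor x), act (fpair e) = x
}.

Definition equivariant (H : topGroupoid) (X Y : topologicalType)
  (a : groupoidAction H X) (b : groupoidAction H Y) (f : X -> Y) :=
  (forall x, anchor b (f x) = anchor a x) /\
  (forall h x (e : src h = anchor a x) (e' : src h = anchor b (f x)),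
    f (act (fpair e)) = act (fpair e')).

Record classicalAction (H G : topGroupoid) := ClassicalAction {
  act_obj : groupoidAction H (obj G);
  act_arr : groupoidAction H (arr G);
  rng_equivariant : equivariant act_arr act_obj (@rng G);
  src_equivariant : equivariant act_arr act_obj (@src G);
  act_mul : forall h g1 g2 (e : src g1 = rng g2)
    (e1 : src h = anchor act_arr g1) (e2 : src h = anchor act_arr g2)
    (e12 : src h = anchor act_arr (gmul (fpair e)))
    (e' : src (act (fpair e1)) = rng (act (fpair e2))),
    act (fpair e12) = gmul (fpair e')
}.

Section FiberProductTheory.
Context (A B C : topologicalType) (f : A -> C) (g : B -> C).
Implicit Types p : fiber_product f g.

Lemma fiber_productP p : f (val p).1 = g (val p).2.
Proof. by have /set_mem := valP p. Qed.

Lemma fpairK p (e : f (val p).1 = g (val p).2) : fpair e = p.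
Proof. by apply: val_inj; case: p e => -[]. Qed.

Lemma fpair_congr a a' b b' (e : f a = g b) (e' : f a' = g b') :
  a = a' -> b = b' -> fpair e = fpair e'.
Proof. by move=> ea eb; apply: val_inj => /=; rewrite ea eb. Qed.

Lemma fp1_continuous :
  continuous (fun p => (val p).1).
Proof.
move=> p; apply: (@continuous_comp _ _ _ (val : fiber_product f g -> _) fst).
  exact: initial_continuous.
exact: cvg_fst.
Qed.

Lemma fp2_continuous :
  continuous (fun p => (val p).2).
Proof.
move=> p; apply: (@continuous_comp _ _ _ (val : fiber_product f g -> _) snd).
  exact: initial_continuous.
exact: cvg_snd.
Qed.

Lemma fpair_continuous (X : topologicalType) (u : X -> A) (v : X -> B)
    (e : forall x, f (u x) = g (v x)) :
  continuous u -> continuous v -> continuous (fun x => fpair (e x)).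
Proof.
move=> cu cv; apply/continuousP => U [W oW <-].
rewrite -comp_preimage.
have cuv : continuous (fun x => (u x, v x)).
  by move=> x; apply: cvg_pair; [exact: cu|exact: cv].
by have /continuousP := cuv; apply.
Qed.

Lemma fp2_open : continuous g -> open_map f ->
  open_map (fun p => (val p).2).
Proof.
move=> cg fo _ [W oW <-]; rewrite openE => _ [p Wp <-].
have [[P Q] /= [+ +] PQW] : nbhs (val p) W by exact: open_nbhs_nbhs.
rewrite nbhsE => -[P' [oP' P'p] P'P] Qp.
rewrite /interior /=.
have cgp : nbhs (val p).2 (g @^-1` (f @` P')).
  apply: cg; apply: open_nbhs_nbhs; split; first exact: fo.
  by exists (val p).1 => //; exact: fiber_productP.
apply: filterS (filterI cgp Qp) => b [[a P'a eab] Qb].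
exists (fpair eab) => //=.
by apply: (PQW (a, b)); split => //; exact: P'P.
Qed.

End FiberProductTheory.

Section GroupoidTheory.
Context (G : topGroupoid).
Implicit Types g : arr G.

Lemma gmul_congr g1 g2 g1' g2' (e : src g1 = rng g2) (e' : src g1' = rng g2') :
  g1 = g1' -> g2 = g2' -> gmul (fpair e) = gmul (fpair e').
Proof. by move=> ? ?; congr gmul; exact: fpair_congr. Qed.

Lemma gunitE g x (e : src x = rng g) : x = gunit (rng g) -> gmul (fpair e) = g.
Proof.
move=> ex; have e' : src (gunit (rng g)) = rng g by rewrite src_unit.
by rewrite -[RHS](gmul1g e'); exact: gmul_congr.
Qed.

Lemma gmulgE g x (e : src g = rng x) : x = gunit (src g) -> gmul (fpair e) = g.
Proof.
move=> ex; have e' : src g = rng (gunit (src g)) by rewrite rng_unit.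
by rewrite -[RHS](gmulg1 e'); exact: gmul_congr.
Qed.

Lemma ginv_unique g g' (e : src g = rng g') :
  gmul (fpair e) = gunit (rng g) -> g' = ginv g.
Proof.
move=> h.
have eV : src (ginv g) = rng g by exact: src_inv.
have e1 : src (gmul (fpair eV)) = rng g' by rewrite src_mul.
have e2 : src (ginv g) = rng (gmul (fpair e)) by rewrite rng_mul.
have := gmulA e1 e2.
rewrite [in X in X -> _]gunitE; last by rewrite gmulVg e.
by move=> ->; apply: gmulgE; rewrite h src_inv.
Qed.

Lemma ginvM g1 g2 (e : src g1 = rng g2) (e' : src (ginv g2) = rng (ginv g1)) :
  ginv (gmul (fpair e)) = gmul (fpair e').
Proof.
have e1 : src (gmul (fpair e)) = rng (gmul (fpair e')).
  by rewrite src_mul rng_mul rng_inv.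
symmetry; apply: (@ginv_unique _ _ e1).
have e2 : src g2 = rng (gmul (fpair e')) by rewrite rng_mul rng_inv.
have e3 : src g1 = rng (gmul (fpair e2)) by rewrite rng_mul.
rewrite (gmulA e1 e3).
have e4 : src g2 = rng (ginv g2) by rewrite rng_inv.
have e5 : src (gmul (fpair e4)) = rng (ginv g1) by rewrite src_mul.
have E : gmul (fpair e2) = ginv g1.
  by rewrite -(gmulA e5 e2); apply: gunitE; rewrite gmulgV rng_inv e.
have e6 : src g1 = rng (ginv g1) by rewrite rng_inv.
by rewrite (gmul_congr e3 e6) // gmulgV rng_mul.
Qed.

Lemma ginvK g : ginv (ginv g) = g.
Proof.
have e : src (ginv g) = rng g by rewrite src_inv.
by symmetry; apply: (@ginv_unique _ _ e); rewrite gmulVg rng_inv.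
Qed.

Lemma ginv1 x : ginv (gunit x) = gunit x :> arr G.
Proof.
have e : src (gunit x) = rng (gunit x) :> obj G by rewrite src_unit rng_unit.
symmetry; apply: (@ginv_unique _ _ e).
by rewrite gunitE // rng_unit.
Qed.

End GroupoidTheory.

Section ActionTheory.
Context (H : topGroupoid) (X : topologicalType) (a : groupoidAction H X).

Lemma act_congr h h' x x' (e : src h = anchor a x) (e' : src h' = anchor a x') :
  h = h' -> x = x' -> act (fpair e) = act (fpair e').
Proof. by move=> ? ?; congr act; exact: fpair_congr. Qed.

Lemma act1E h x (e : src h = anchor a x) :
  h = gunit (anchor a x) -> act (fpair e) = x.
Proof.
move=> eh; have e' : src (gunit (anchor a x)) = anchor a x by rewrite src_unit.
by rewrite -[RHS](act1 e'); exact: act_congr.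
Qed.

Lemma actV h h' x (e : src h = anchor a x)
    (e' : src h' = anchor a (act (fpair e))) : h' = ginv h ->
  act (fpair e') = x.
Proof.
move=> E; have e1 : src h' = rng h by rewrite E src_inv.
have e2 : src (gmul (fpair e1)) = anchor a x by rewrite src_mul.
rewrite (actA e' e2); apply: act1E.
have e3 : src (ginv h) = rng h by rewrite src_inv.
by rewrite (gmul_congr e1 e3) // gmulVg e.
Qed.

End ActionTheory.

Section TransformationGroupoid.
Context (H G : topGroupoid) (A : classicalAction H G).

Let a0 := act_obj A.
Let a1 := act_arr A.

Lemma anchor_rng g : anchor a0 (rng g) = anchor a1 g.
Proof. by case: (rng_equivariant A). Qed.

Lemma anchor_src g : anchor a0 (src g) = anchor a1 g.
Proof. by case: (src_equivariant A). Qed.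

Lemma rng_act h g (e : src h = anchor a1 g) (e' : src h = anchor a0 (rng g)) :
  rng (act (fpair e)) = act (fpair e').
Proof. by case: (rng_equivariant A) => _; apply. Qed.

Lemma src_act h g (e : src h = anchor a1 g) (e' : src h = anchor a0 (src g)) :
  src (act (fpair e)) = act (fpair e').
Proof. by case: (src_equivariant A) => _; apply. Qed.

Lemma anchor_mul g1 g2 (e : src g1 = rng g2) :
  anchor a1 (gmul (fpair e)) = anchor a1 g2.
Proof. by rewrite -anchor_src src_mul anchor_src. Qed.

Lemma act_unit h x (e : src h = anchor a1 (gunit x)) :
  act (fpair e) = gunit (rng (act (fpair e))).
Proof.
set u := act _.
have e0 : src (gunit x) = rng (gunit x) :> obj G by rewrite src_unit rng_unit.
have E0 : gmul (fpair e0) = gunit x by apply: gunitE; rewrite rng_unit.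
have e12 : src h = anchor a1 (gmul (fpair e0)) by rewrite E0.
have eu : src u = rng u.
  have er : src h = anchor a0 (rng (gunit x)) by rewrite anchor_rng.
  have es : src h = anchor a0 (src (gunit x)) by rewrite anchor_src.
  rewrite /u (rng_act e er) (src_act e es).
  by apply: act_congr => //; rewrite src_unit rng_unit.
have Eu : gmul (fpair eu) = u.
  by rewrite -(act_mul e12 eu); exact: act_congr.
have eV : src (ginv u) = rng u by rewrite src_inv.
have e1 : src (gmul (fpair eV)) = rng u by rewrite src_mul.
have e2 : src (ginv u) = rng (gmul (fpair eu)) by rewrite Eu.
have := gmulA e1 e2; rewrite [in X in X -> _]gunitE; last by rewrite gmulVg eu.
by move=> E1; rewrite {1}E1 (gmul_congr e2 eV) // gmulVg eu.
Qed.

Definition trans_arr : topologicalType := fiber_product (@src H) (anchor a1).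

Implicit Types l : trans_arr.

Lemma trans_arrP l : src (val l).1 = anchor a1 (val l).2.
Proof. exact: fiber_productP. Qed.

Lemma trans_rng_subproof l : src (val l).1 = anchor a0 (rng (val l).2).
Proof. by rewrite anchor_rng trans_arrP. Qed.

(* s(h, g) = s(g) *)
Definition trans_src l : obj G := src (val l).2.

(* r(h, g) = h . r(g) *)
Definition trans_rng l : obj G := act (fpair (trans_rng_subproof l)).

Lemma anchor_trans_rng l : anchor a0 (trans_rng l) = rng (val l).1.
Proof. by rewrite /trans_rng anchor_act. Qed.

Lemma anchor_trans_src l : anchor a0 (trans_src l) = src (val l).1.
Proof. by rewrite /trans_src anchor_src trans_arrP. Qed.

Section Mul.
Variable p : fiber_product trans_src trans_rng.
Let h1 := (val (val p).1).1.
Let g1 := (val (val p).1).2.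
Let h2 := (val (val p).2).1.
Let g2 := (val (val p).2).2.

Lemma trans_mul_subproof1 : src h1 = rng h2.
Proof. by rewrite -anchor_trans_src fiber_productP anchor_trans_rng. Qed.

Lemma trans_mul_subproof2 : src (ginv h2) = anchor a1 g1.
Proof. by rewrite src_inv -trans_mul_subproof1 trans_arrP. Qed.

Lemma trans_mul_subproof3 : src (act (fpair trans_mul_subproof2)) = rng g2.
Proof.
have e1 : src (ginv h2) = anchor a0 (src g1).
  by rewrite anchor_src trans_mul_subproof2.
rewrite (src_act _ e1).
have e2 : src (ginv h2) = anchor a0 (trans_rng (val p).2).
  by rewrite src_inv anchor_trans_rng.
rewrite (act_congr e1 e2) //; last exact: (fiber_productP p).
exact: actV.
Qed.

Lemma trans_mul_subproof4 :
  src (gmul (fpair trans_mul_subproof1)) =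
  anchor a1 (gmul (fpair trans_mul_subproof3)).
Proof. by rewrite src_mul anchor_mul -trans_arrP. Qed.

(* (h1, g1) (h2, g2) = (h1 h2, (h2^-1 . g1) g2) *)
Definition trans_mul : trans_arr := fpair trans_mul_subproof4.

End Mul.

Section Inv.
Variable l : trans_arr.

Lemma trans_inv_subproof1 : src (val l).1 = anchor a1 (ginv (val l).2).
Proof. by rewrite -anchor_rng rng_inv anchor_src trans_arrP. Qed.

Lemma trans_inv_subproof2 :
  src (ginv (val l).1) = anchor a1 (act (fpair trans_inv_subproof1)).
Proof. by rewrite src_inv anchor_act. Qed.

(* The inverse forced by the product: (h, g)^-1 = (h^-1, h . g^-1). *)
Definition trans_inv : trans_arr := fpair trans_inv_subproof2.

End Inv.

Lemma trans_unit_subproof (x : obj G) :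
  src (gunit (anchor a0 x)) = anchor a1 (gunit x).
Proof. by rewrite src_unit -anchor_rng rng_unit. Qed.

Definition trans_unit (x : obj G) : trans_arr := fpair (trans_unit_subproof x).

Lemma trans_src_continuous : continuous trans_src.
Proof.
move=> l; apply: (@continuous_comp _ _ _ (fun l => (val l).2) (@src G)).
  exact: fp2_continuous.
exact: src_continuous.
Qed.

Lemma comp_continuous (X Y Z : topologicalType) (f : X -> Y) (g : Y -> Z) :
  continuous f -> continuous g -> continuous (g \o f).
Proof. by move=> cf cg x; apply: continuous_comp; [exact: cf|exact: cg]. Qed.

Lemma trans_rng_continuous : continuous trans_rng.
Proof.
apply: (@comp_continuous _ _ _ (fun l => fpair (trans_rng_subproof l))
  (@act _ _ a0));
  last exact: act_continuous.
apply: fpair_continuous; first exact: fp1_continuous.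
apply: (@comp_continuous _ _ _ (fun l => (val l).2) (@rng G)).
  exact: fp2_continuous.
exact: rng_continuous.
Qed.

Lemma trans_src_open : open_map trans_src.
Proof.
move=> U oU.
have -> : trans_src @` U = (@src G) @` ((fun l => (val l).2) @` U).
  by rewrite -image_comp.
apply: src_open; apply: fp2_open => //.
- exact: anchor_continuous.
- exact: src_open.
Qed.

Lemma trans_inv_continuous : continuous trans_inv.
Proof.
apply: fpair_continuous.
  apply: (@comp_continuous _ _ _ (fun l => (val l).1) (@ginv H)).
    exact: fp1_continuous.
  exact: ginv_continuous.
apply: (@comp_continuous _ _ _ (fun l => fpair (trans_inv_subproof1 l))
  (@act _ _ a1));
  last exact: act_continuous.
apply: fpair_continuous; first exact: fp1_continuous.
apply: (@comp_continuous _ _ _ (fun l => (val l).2) (@ginv G)).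
  exact: fp2_continuous.
exact: ginv_continuous.
Qed.

Lemma trans_unit_continuous : continuous trans_unit.
Proof.
apply: fpair_continuous; last exact: gunit_continuous.
apply: (@comp_continuous _ _ _ (anchor a0) (@gunit H)).
  exact: anchor_continuous.
exact: gunit_continuous.
Qed.

Lemma trans_mul_continuous : continuous trans_mul.
Proof.
have c1 : continuous (fun p : fiber_product trans_src trans_rng =>
    (val p).1 : trans_arr) by exact: fp1_continuous.
have c2 : continuous (fun p : fiber_product trans_src trans_rng =>
    (val p).2 : trans_arr) by exact: fp2_continuous.
have ch : continuous (fun l => (val l).1) by exact: fp1_continuous.
have cg : continuous (fun l => (val l).2) by exact: fp2_continuous.
apply: fpair_continuous.
  apply: (@comp_continuous _ _ _ (fun p => fpair (trans_mul_subproof1 p))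
    (@gmul H)); last exact: gmul_continuous.
  by apply: fpair_continuous;
    [exact: (comp_continuous c1 ch)|exact: (comp_continuous c2 ch)].
apply: (@comp_continuous _ _ _ (fun p => fpair (trans_mul_subproof3 p))
  (@gmul G)); last exact: gmul_continuous.
apply: fpair_continuous; last exact: (comp_continuous c2 cg).
apply: (@comp_continuous _ _ _ (fun p => fpair (trans_mul_subproof2 p))
  (@act _ _ a1)); last exact: act_continuous.
apply: fpair_continuous; last exact: (comp_continuous c1 cg).
exact: (comp_continuous (comp_continuous c2 ch) (@ginv_continuous H)).
Qed.

Lemma trans_eq l l' : (val l).1 = (val l').1 -> (val l).2 = (val l').2 -> l = l'.
Proof.
move=> h1 h2; apply: val_inj.
by rewrite [LHS]surjective_pairing h1 h2 -surjective_pairing.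
Qed.

Lemma trans_src_inv l : trans_src (trans_inv l) = trans_rng l.
Proof.
rewrite /trans_src /trans_inv /=.
have e : src (val l).1 = anchor a0 (src (ginv (val l).2)).
  by rewrite src_inv anchor_rng trans_arrP.
by rewrite (src_act _ e); apply: act_congr => //; rewrite src_inv.
Qed.

Lemma trans_invK l : trans_inv (trans_inv l) = l.
Proof.
apply: trans_eq => /=; first by rewrite ginvK.
have e1 : src (val l).1 = anchor a1 (ginv (val l).2) by exact: trans_inv_subproof1.
set u := act _.
have <- : ginv (ginv (val l).2) = (val l).2 by rewrite ginvK.
have e0 : src (ginv (val l).2) = rng (ginv (ginv (val l).2)).
  by rewrite rng_inv.
have el : src (val l).1 = anchor a1 (ginv (ginv (val l).2)).
  by rewrite ginvK trans_arrP.
have e12 : src (val l).1 = anchor a1 (gmul (fpair e0)).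
  by rewrite anchor_mul.
have ee : src (act (fpair e1)) = rng (act (fpair el)).
  have ea : src (val l).1 = anchor a0 (src (ginv (val l).2)).
    by rewrite anchor_src.
  have eb : src (val l).1 = anchor a0 (rng (ginv (ginv (val l).2))).
    by rewrite anchor_rng.
  rewrite (src_act _ ea) (rng_act _ eb).
  by apply: act_congr => //; rewrite rng_inv.
have E : ginv (act (fpair e1)) = act (fpair el).
  symmetry; apply: (@ginv_unique _ _ _ ee).
  rewrite -(act_mul e12 ee).
  have e3 : src (val l).1 = anchor a1 (gunit (rng (ginv (val l).2))).
    by rewrite -anchor_rng rng_unit anchor_rng.
  rewrite (act_congr e12 e3) //; last by rewrite gmulgV.
  rewrite act_unit; congr gunit.
  have ea : src (val l).1 = anchor a0 (rng (gunit (rng (ginv (val l).2)))).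
    by rewrite rng_unit anchor_rng.
  have eb : src (val l).1 = anchor a0 (rng (ginv (val l).2)).
    by rewrite anchor_rng.
  by rewrite (rng_act _ ea) (rng_act _ eb); apply: act_congr => //; rewrite rng_unit.
have e4 : src (ginv (val l).1) = anchor a1 (act (fpair el)).
  by rewrite src_inv anchor_act.
rewrite /u (act_congr _ e4) //; last first.
  by rewrite -E; congr ginv; exact: act_congr.
exact: actV.
Qed.

Lemma trans_rng_inv l : trans_rng (trans_inv l) = trans_src l.
Proof. by rewrite -trans_src_inv trans_invK. Qed.

Lemma trans_rng_open : open_map trans_rng.
Proof.
move=> U oU.
have -> : trans_rng @` U = trans_src @` (trans_inv @^-1` U).
  apply/seteqP; split=> [_ [l Ul <-]|_ [l Ul <-]].
    exists (trans_inv l); last exact: trans_src_inv.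
    by rewrite /preimage/= trans_invK.
  by exists (trans_inv l) => //; exact: trans_rng_inv.
by apply: trans_src_open; have /continuousP := trans_inv_continuous; apply.
Qed.

Lemma trans_src_mul l1 l2 (e : trans_src l1 = trans_rng l2) :
  trans_src (trans_mul (fpair e)) = trans_src l2.
Proof. by rewrite /trans_src /trans_mul /= src_mul. Qed.

Lemma trans_rng_mul l1 l2 (e : trans_src l1 = trans_rng l2) :
  trans_rng (trans_mul (fpair e)) = trans_rng l1.
Proof.
rewrite /trans_rng /trans_mul /=.
set e12 := trans_mul_subproof1 _; set e0 := trans_rng_subproof _.
have [/= d2 d3] := (trans_mul_subproof2 (fpair e), trans_mul_subproof3 (fpair e)).
have r1 : src (ginv (val l2).1) = anchor a0 (rng (val l1).2).
  by rewrite anchor_rng.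
have r2 : src (val l2).1 = anchor a0 (act (fpair r1)).
  by rewrite anchor_act rng_inv.
have r3 : src (gmul (fpair e12)) = anchor a0 (act (fpair r1)).
  by rewrite src_mul.
rewrite (act_congr _ r3) //; last first.
  by rewrite rng_mul /=; exact: rng_act.
have r4 : src (val l1).1 = anchor a0 (act (fpair r2)).
  by rewrite anchor_act; exact: e12.
rewrite -(actA r4 r3); apply: act_congr => //.
by apply: actV; rewrite ginvK.
Qed.

Lemma trans_mulA l1 l2 l3 (e12 : trans_src l1 = trans_rng l2)
    (e23 : trans_src l2 = trans_rng l3)
    (e : trans_src (trans_mul (fpair e12)) = trans_rng l3)
    (e' : trans_src l1 = trans_rng (trans_mul (fpair e23))) :
  trans_mul (fpair e) = trans_mul (fpair e').
Proof.
apply: trans_eq; first exact: gmulA.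
pose C2 := trans_mul_subproof2 (fpair e23).
pose C3 : src (act (fpair C2)) = rng (val l3).2 := trans_mul_subproof3 (fpair e23).
pose D2 := trans_mul_subproof2 (fpair e12).
have f1 : src (ginv (val l3).1) = anchor a1 (act (fpair D2)).
  by rewrite anchor_act src_inv rng_inv -(trans_mul_subproof1 (fpair e23)).
have f2 : src (act (fpair f1)) = rng (act (fpair C2)).
  have ea : src (ginv (val l3).1) = anchor a0 (src (act (fpair D2))).
    by rewrite anchor_src.
  have eb : src (ginv (val l3).1) = anchor a0 (rng (val l2).2).
    by rewrite anchor_rng; exact: C2.
  rewrite (src_act _ ea) (rng_act _ eb); apply: act_congr => //.
  exact: (trans_mul_subproof3 (fpair e12)).
have f3 : src (gmul (fpair f2)) = rng (val l3).2 by rewrite src_mul.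
transitivity (gmul (fpair f3)).
  by apply: gmul_congr => //; exact: act_mul.
have f4 : src (act (fpair f1)) = rng (gmul (fpair C3)) by rewrite rng_mul.
rewrite (gmulA f3 f4); apply: gmul_congr => //.
have f5 : src (ginv (val l3).1) = rng (ginv (val l2).1).
  by rewrite src_inv rng_inv -(trans_mul_subproof1 (fpair e23)).
have f6 : src (gmul (fpair f5)) = anchor a1 (val l1).2.
  by rewrite src_mul; exact: D2.
by rewrite (actA f1 f6); apply: act_congr => //; rewrite (ginvM _ f5).
Qed.

Lemma trans_rng_unit x : trans_rng (trans_unit x) = x.
Proof.
by rewrite /trans_rng act1E /= ?rng_unit.
Qed.

Lemma trans_src_unit x : trans_src (trans_unit x) = x.
Proof. by rewrite /trans_src /= src_unit. Qed.

Lemma trans_mul1l l (e : trans_src (trans_unit (trans_rng l)) = trans_rng l) :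
  trans_mul (fpair e) = l.
Proof.
apply: trans_eq => /=.
  by apply: gunitE; rewrite -anchor_trans_rng.
apply: gunitE; rewrite act_unit; congr gunit.
have := trans_mul_subproof3 (fpair e); rewrite /= => <-.
by rewrite act_unit src_unit rng_unit.
Qed.

Lemma trans_mull1 l (e : trans_src l = trans_rng (trans_unit (trans_src l))) :
  trans_mul (fpair e) = l.
Proof.
have E : anchor a0 (trans_src l) = anchor a1 (val l).2.
  by rewrite /trans_src anchor_src.
apply: trans_eq => /=.
  by apply: gmulgE; rewrite anchor_trans_src.
rewrite gmulgE; first by apply: act1E; rewrite ginv1 E.
by rewrite act1E // ginv1 E.
Qed.

Lemma trans_mulVl l (e : trans_src (trans_inv l) = trans_rng l) :
  trans_mul (fpair e) = trans_unit (trans_src l).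
Proof.
apply: trans_eq => /=.
  by rewrite gmulVg anchor_trans_src.
set d := trans_mul_subproof3 _.
have f : src (ginv (val l).2) = rng (val l).2 by rewrite src_inv.
rewrite (gmul_congr d f) // ?gmulVg //.
exact: actV.
Qed.

Lemma trans_mullV l (e : trans_src l = trans_rng (trans_inv l)) :
  trans_mul (fpair e) = trans_unit (trans_rng l).
Proof.
have e1 : trans_src (trans_inv (trans_inv l)) = trans_rng (trans_inv l).
  by rewrite trans_src_inv.
have -> : fpair e = fpair e1.
  by apply: fpair_congr => //; rewrite trans_invK.
by rewrite trans_mulVl trans_src_inv.
Qed.

Definition transformation_groupoid : topGroupoid := TopGroupoid
  trans_rng_continuous trans_src_continuous trans_rng_open trans_src_open
  trans_mul_continuous trans_inv_continuous trans_unit_continuous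
  trans_rng_mul trans_src_mul trans_mulA trans_rng_unit trans_src_unit
  trans_mul1l trans_mull1 trans_rng_inv trans_src_inv trans_mulVl trans_mullV.

End TransformationGroupoid.

(* Main.v *)
(** The map [(F^1, s)] sends [(h, g)] to [(h, s(g))], so it is the base change of
    the open map [s : G^1 -> G^0] along the projection to [G^0]. It is onto
    because [(h, x)] is the image of [(h, 1_x)]. *)
Require Import Defs.
From mathcomp Require Import all_boot.
From mathcomp Require Import all_classical topology.

Local Open Scope classical_set_scope.

(** Since [g] factors through [k], the map [u] is a base change of [k]: it sends the trace of a box
    with sides [P] and [Q'] onto the trace of the box with sides [P] and [k(Q')]. *)
Lemma fiber_product_map_open (A B B' C : topologicalType) (f : A -> C)
    (g : B -> C) (g' : B' -> C) (k : B -> B') (gk : forall b, g' (k b) = g b)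
    (u : fiber_product f g -> fiber_product f g') :
  (forall p, val (u p) = ((val p).1, k (val p).2)) ->
  open_map k -> open_map u.
Proof.
move=> uE ko _ [W oW <-]; rewrite openE => _ [p Wp <-].
have [[P Q] /= [Pp +] PQW] : nbhs (val p) W by exact: open_nbhs_nbhs.
(* Shrinking [Q] to an open [Q'] makes [k(Q')] open. *)
rewrite nbhsE => -[Q' [oQ' Q'p] Q'Q].
have Nu : nbhs (val (u p)) (P `*` (k @` Q')).
  exists (P, k @` Q') => //; rewrite uE; split => //=.
  by apply: open_nbhs_nbhs; split; [exact: ko | exists (val p).2].
have {Nu} : nbhs (u p) (val @^-1` (P `*` (k @` Q'))).
  exact: initial_continuous Nu.
apply: (@filterS _ (nbhs (u p))) => q [/= Pq [b Q'b kb]].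
(* Every lift [b] along [k] is automatically compatible with the first coordinate. *)
have e : f (val q).1 = g b by rewrite fiber_productP -kb gk.
exists (fpair e); first by apply: (PQW (_, _)); split => //; exact: Q'Q.
by apply: val_inj; rewrite uE /= kb -surjective_pairing.
Qed.

Section TransformationFunctor.
Context (H G : topGroupoid) (A : classicalAction H G).

(** The first component of a product is [h1 h2] by construction; only the proofs of composability
    can differ. *)
Lemma transformation_pr1_mul (l1 l2 : trans_arr A)
    (e : trans_src l1 = trans_rng l2) (e' : src (val l1).1 = rng (val l2).1) :
  (val (trans_mul (fpair e))).1 = gmul (fpair e').
Proof. exact: gmul_congr. Qed.

(** Ranges match because [h . r(g)] is anchored at [r(h)], sources because [src] is equivariant. *)
Definition transformation_functor :
    continuousFunctor (transformation_groupoid A) H :=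
  @ContinuousFunctor (transformation_groupoid A) H
    (anchor (act_obj A)) (fun l : trans_arr A => (val l).1)
    (@anchor_continuous _ _ (act_obj A)) (@fp1_continuous _ _ _ _ _)
    (fun l => esym (anchor_trans_rng l)) (fun l => esym (anchor_trans_src l))
    transformation_pr1_mul.

Lemma transformation_functor_fibration :
  groupoid_fibration transformation_functor.
Proof.
split.
  apply: (@fiber_product_map_open _ _ _ _ _ _ _ (@src G)) => //.
    exact: anchor_src.
  exact: src_open.
rewrite -subTset => q _.
(* The unit at [x] has the anchor of its source [x], so [(h, 1_x)] is an arrow. *)
have e : src (val q).1 = anchor (act_arr A) (@gunit G (val q).2).
  by rewrite -anchor_src src_unit fiber_productP.
exists (fpair e) => //; apply: val_inj.
by rewrite /= /trans_src /= src_unit -surjective_pairing.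
Qed.

End TransformationFunctor.

Theorem proposition2p15 (H G : topGroupoid) (A : classicalAction H G) :
  exists F : continuousFunctor (transformation_groupoid A) H,
    [/\ fobj F = anchor (act_obj A),
        farr F = (fun l : fiber_product (@src H) (anchor (act_arr A)) =>
                    (val l).1)
      & groupoid_fibration F].
Proof.
exists (transformation_functor H G A); split => //.
exact: transformation_functor_fibration.
Qed.
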